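(* Let $m \ge 2$ be even and $n \ge 4$ be even. The honeycomb toroidal graph $\mathrm{HTG}(m,n,2)$ is 2-spanning cyclable if and only if $(m,n) = (2,4)$, or $m \geq 4$ and $n \geq 6$.
   Context: For integers $m\ge 1$, $\ell\ge 0$ and $n\ge 4$ with $n$ even and $m-\ell$ even, the honeycomb toroidal graph $\mathrm{HTG}(m,n,\ell)$ is the simple graph with vertex set $\{u_{i,j}: 0\le i\le m-1,\ 0\le j\le n-1\}$ (first subscript computed modulo $m$, second modulo $n$) whose edge set is the set of the following unordered pairs: $\{u_{i,j},u_{i,j+1}\}$ for all $i,j$ (vertical edges); $\{u_{i,j},u_{i+1,j}\}$ for all $0\le i\le m-2$ with $i+j$ odd (flat edges); and $\{u_{m-1,j},u_{0,j+\ell}\}$ for all $j$ having the same parity as $m$ (and $\ell$) (jump edges). (Repeated pairs give a single edge.) A 2-factor of a graph is a spanning subgraph in which every vertex has valency 2. A graph $X$ is 2-spanning cyclable if for every pair of distinct vertices $u,v$ of $X$ there is a 2-factor of $X$ consisting of exactly two cycles such that $u$ and $v$ lie in different cycles. *)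

(* Defs.v *)
From mathcomp Require Import all_boot.

Set Implicit Arguments.
Unset Strict Implicit.
Unset Printing Implicit Defensive.

(* A finite simple graph on T is a symmetric irreflexive relation e : rel T. *)
Section Graphs.

Variable T : finType.
Implicit Types (e F : rel T) (c : seq T).

Definition spanning_subgraph e F : Prop := symmetric F /\ subrel F e.

Definition valency F (x : T) : nat := #|[set y | F x y]|.

Definition two_factor e F : Prop :=
  spanning_subgraph e F /\ forall x, valency F x = 2.

(* [ucycle e c] alone also accepts sequences of length 0, 1 and 2. *)
Definition graph_cycle e c : Prop := ucycle e c /\ 3 <= size c.

Definition cycle_edge c : rel T := fun x y =>
  [&& x \in c, y \in c & (y == next c x) || (x == next c y)].

Definition consists_of_two_cycles F c1 c2 : Prop :=
  [/\ graph_cycle F c1, graph_cycle F c2, [disjoint c1 & c2]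
    & F =2 (fun x y => cycle_edge c1 x y || cycle_edge c2 x y)].

Definition two_spanning_cyclable e : Prop :=
  forall u v : T, u != v ->
  exists F : rel T, two_factor e F /\
  exists c1 c2 : seq T,
    [/\ consists_of_two_cycles F c1 c2, u \in c1 & v \in c2].

End Graphs.

(* The vertex u_{i,j} is the pair (i, j). *)
Definition htg_vertex (m n : nat) : finType := ('I_m * 'I_n)%type.

Section HTG.

Variables m n l : nat.
Implicit Types u v : htg_vertex m n.

Definition htg_vertical u v : bool :=
  (u.1 == v.1) && (v.2 == u.2.+1 %[mod n]).

(* The bound i <= m - 2 is implied by i + 1 being the index of v. *)
Definition htg_flat u v : bool :=
  [&& v.1 == u.1.+1 :> nat, odd (u.1 + u.2) & v.2 == u.2].

Definition htg_jump u v : bool :=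
  [&& u.1 == m.-1 :> nat, v.1 == 0 :> nat, odd u.2 == odd m
    & v.2 == u.2 + l %[mod n]].

Definition htg : rel (htg_vertex m n) := fun u v =>
  [|| htg_vertical u v, htg_flat u v, htg_jump u v,
      htg_vertical v u, htg_flat v u | htg_jump v u].

Lemma htg_sym : symmetric htg.
Proof.
move=> u v; rewrite /htg.
by case: (htg_vertical u v); case: (htg_flat u v); case: (htg_jump u v);
   case: (htg_vertical v u); case: (htg_flat v u); case: (htg_jump v u).
Qed.

Lemma htg_irrefl : 4 <= n -> ~~ odd n -> odd m = odd l -> irreflexive htg.
Proof.
move=> n4 evn eqml u; rewrite /htg.
have -> : htg_vertical u u = false.
  rewrite /htg_vertical eqxx /= -addn1 -[X in X == _ %[mod _]]addn0 eqn_modDl.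
  by rewrite mod0n modn_small // (leq_trans _ n4).
have -> : htg_flat u u = false by rewrite /htg_flat ltn_eqF.
suff -> : htg_jump u u = false by [].
apply/negP=> /and4P[/eqP u1 /eqP u0 _].
rewrite -[X in X == _ %[mod _]]addn0 eqn_modDl mod0n eq_sym => /eqP dnl.
have nl : n %| l by rewrite /dvdn dnl.
have m1 : m = 1.
  by have := ltn_ord u.1; rewrite u0 => /prednK <-; rewrite -u1 u0.
have odl : odd l by rewrite -eqml m1.
by move: evn; rewrite (dvdn_odd nl odl).
Qed.

End HTG.

(* Main.v *)
Require Import Defs.
From mathcomp Require Import all_boot zify.

(* A 2-factor of a cubic graph is the complement of a perfect matching, which is
   recorded by the direction [M x] of the edge it omits at each vertex [x].

   A separating 2-factor of HTG(m, n, 2) extends to HTG(m + 2, n, 2): append two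
   columns and replace each used jump edge, say in row [j], by the path that
   climbs the first new column up to the row below the next used one, crosses,
   and comes back down the second.  For m = 4 it also extends to
   HTG(4, n + 2, 2) when it has a seam, that is, a height at which all the
   vertical edges and none of the jump edges of the 2-factor cross: the new rows
   only lengthen the vertical edges there.  Since HTG(m, n, 2) is
   vertex-transitive, the search is thereby reduced to HTG(4, 6, 2),
   HTG(4, 8, 2) and HTG(2, 4, 2) with u = (0, 0), where three matchings
   suffice each.

   In the remaining cases (n = 4 and m >= 4, or m = 2 and n >= 6) the graph is a
   ring of at least three 4-cycles, consecutive ones being joined by two edges,
   and the ends of such an edge lie on the same cycle of any 2-factor made of
   two cycles. *)

Set Implicit Arguments.
Unset Strict Implicit.
Unset Printing Implicit Defensive.

(** * Matchings as labels, and 2-factors separating two vertices *)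

Definition dir := option bool.
Notation Up := (Some true) (only parsing).
Notation Dn := (Some false) (only parsing).
Notation Fl := None (only parsing).
(** Flat and jump edges share the label [Fl], since each vertex has exactly one of them; seen from
    its other end such an edge is [Fl] again. *)
Definition flip (d : dir) : dir := omap negb d.

Definition vertex := (nat * nat)%type.

Definition incr n j := if j.+1 < n then j.+1 else 0.
Definition decr n j := if j == 0 then n.-1 else j.-1.
Definition add2 n j := if j.+2 < n then j.+2 else j.+2 - n.
Definition sub2 n j := if 1 < j then j - 2 else j + n - 2.

(** For even [m] a jump edge leaves the last column at an even row, hence at an odd coordinate sum,
    just as a flat edge does; the parity of the sum thus decides which way the third edge goes. *)
Definition step m n (d : dir) (x : vertex) : vertex :=
  match d with
  | Up => (x.1, incr n x.2)
  | Dn => (x.1, decr n x.2)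
  | Fl => if odd (x.1 + x.2)
          then if x.1.+1 < m then (x.1.+1, x.2) else (0, add2 n x.2)
          else if 0 < x.1 then (x.1.-1, x.2) else (m.-1, sub2 n x.2)
  end.

Definition inside m n (x : vertex) := (x.1 < m) && (x.2 < n).

Definition matched m n (M : vertex -> dir) := forall x d, inside m n x ->
  (M (step m n d x) == flip d) = (M x == d).

(** On the vertices, such predicates are the unions of components of the 2-factor, so that
    connectivity is argued without paths. *)
Definition constant_along m n (M : vertex -> dir) (P : pred vertex) :=
  forall x d, inside m n x -> M x != d -> P (step m n d x) = P x.

(* For a [matched] label [M], the 2-factor omitting the edges [M x] has exactly
   two components, one through [u] and one through [v]: [X] tells them apart,
   and there is no third one. *)
Definition separates m n M u v :=
  [/\ matched m n M,
      exists X, [/\ constant_along m n M X, X u & ~~ X v]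
    & forall P, constant_along m n M P -> P u -> P v ->
        forall x, inside m n x -> P x].

Definition separable m n u v := exists M, separates m n M u v.

Ltac unfold_step := rewrite /inside /step /incr /decr /add2 /sub2 /=.
(* Boolean facts about labels and colours are opaque to [lia] but make it split. *)
Ltac nat_lia := repeat match goal with
  | H : context [inside] |- _ => clear H
  | H : context [_ (_, _)] |- _ => clear H
  end; lia.
Ltac split_ifs := intros; repeat match goal with
  | |- context [if ?b then _ else _] => lazymatch b with
      | context [if _ then _ else _] => fail
      | _ => destruct b eqn:?; try (exfalso; lia); rewrite /=
      end
  end.
Ltac pair_lia := intros; try (congr pair); lia.

(** * Steps in the graph and its automorphisms *)

Section Steps.
Variables m n : nat.
Hypotheses (m_gt1 : 2 <= m) (em : ~~ odd m) (n_gt3 : 4 <= n) (en : ~~ odd n).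

Lemma inside_step d x : inside m n x -> inside m n (step m n d x).
Proof. by case: d x => [[]|] [i j]; unfold_step; split_ifs; lia. Qed.

Lemma odd_step d x : inside m n x ->
  odd ((step m n d x).1 + (step m n d x).2) = ~~ odd (x.1 + x.2).
Proof. by case: d x => [[]|] [i j]; unfold_step; split_ifs; lia. Qed.

Lemma stepK d x : inside m n x -> step m n (flip d) (step m n d x) = x.
Proof.
by case: d x => [[]|] [i j]; unfold_step; split_ifs; pair_lia.
Qed.

(** This makes the graph cubic: up and down differ because [n > 2], and the third edge changes
    column because [m > 1]. *)
Lemma eq_step d d' x : inside m n x ->
  (step m n d x == step m n d' x) = (d == d').
Proof.
move=> xV; have [->|] := eqVneq d d'; first by rewrite eqxx.
case: d d' x xV => [[]|] [[]|] [i j] // + _; unfold_step; split_ifs;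
  rewrite xpair_eqE; lia.
Qed.

(* Each edge is once an upward step, or once a flat step from a vertex with odd
   coordinate sum. *)
Lemma matchedP M :
  (forall x, inside m n x -> (M (step m n Up x) == Dn) = (M x == Up)) ->
  (forall x, inside m n x -> odd (x.1 + x.2) ->
     (M (step m n Fl x) == Fl) = (M x == Fl)) ->
  matched m n M.
Proof.
move=> MU MF x [[]|] xV; first exact: MU.
  by rewrite -(MU _ (inside_step Dn xV)) (stepK Dn xV).
case o: (odd (x.1 + x.2)); first exact: MF.
by rewrite -(MF _ (inside_step Fl xV)) ?odd_step ?o // (stepK Fl xV).
Qed.

Lemma matched_step_neq M d x : matched m n M -> inside m n x ->
  (M (step m n d x) != flip d) = (M x != d).
Proof. by move=> MM xV; rewrite MM. Qed.

Lemma constant_alongP M P : matched m n M ->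
  (forall x, inside m n x -> M x != Up -> P (step m n Up x) = P x) ->
  (forall x, inside m n x -> odd (x.1 + x.2) -> M x != Fl ->
     P (step m n Fl x) = P x) ->
  constant_along m n M P.
Proof.
move=> MM PU PF x [[]|] xV Mx; first exact: PU.
  have := PU _ (inside_step Dn xV); rewrite (stepK Dn xV) => -> //.
  by rewrite (matched_step_neq Dn).
case o: (odd (x.1 + x.2)); first exact: PF.
have := PF _ (inside_step Fl xV); rewrite (stepK Fl xV) => -> //.
  by rewrite odd_step ?o.
by rewrite (matched_step_neq Fl).
Qed.

(** Pulls a 2-factor back along an automorphism [g] with inverse [g']; [p] is the effect of [g] on
    directions, the identity for translations and [flip] for the half-turn. *)
Lemma separates_transport M (p : dir -> dir) g g' u v :
  involutive p -> (forall d, p (flip d) = flip (p d)) ->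
  (forall x, inside m n x -> inside m n (g x)) ->
  (forall x, inside m n x -> inside m n (g' x)) ->
  (forall x, inside m n x -> g' (g x) = x) ->
  (forall x, inside m n x -> g (g' x) = x) ->
  (forall x d, inside m n x -> step m n (p d) (g x) = g (step m n d x)) ->
  inside m n u -> inside m n v ->
  separates m n M (g u) (g v) -> separates m n (p \o M \o g) u v.
Proof.
move=> pK pf gV g'V gK g'K gs uV vV [MM [X [cX Xu Xv]] R].
have pE a b : (p a == b) = (a == p b).
  by rewrite -{1}[b]pK inj_eq //; exact: inv_inj.
split.
- by move=> x d xV /=; rewrite pE -gs // pf MM ?gV // pE.
- exists (X \o g); split=> //= x d xV Mx /=.
  by rewrite -gs // cX ?gV // -pE.
move=> P cP Pu Pv x xV.
have {}R := R (P \o g'); rewrite -(gK x xV); apply: R; rewrite /= ?gK ?gV //.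
move=> y d yV My /=.
have -> : g' (step m n d y) = step m n (p d) (g' y).
  by rewrite -{1}(g'K y yV) -{1}[d]pK gs ?g'V // gK // inside_step // g'V.
by apply: cP; rewrite ?g'V //= g'K // pE pK.
Qed.

(** A move of one column to the right must go with one row up, to preserve the parity of the
    coordinate sum; wrapping around adds the offset 2 of the jump edges. *)
Definition shift (x : vertex) : vertex :=
  if x.1.+1 < m then (x.1.+1, incr n x.2) else (0, incr n (add2 n x.2)).

Definition unshift (x : vertex) : vertex :=
  if 0 < x.1 then (x.1.-1, decr n x.2) else (m.-1, sub2 n (decr n x.2)).

Definition raise (x : vertex) : vertex := (x.1, add2 n x.2).

(* Exchanges the parities of the coordinate sum. *)
Definition turn (x : vertex) : vertex :=
  (m.-1 - x.1, if x.2 == 0 then 0 else n - x.2).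

Lemma inside_shift x : inside m n x -> inside m n (shift x).
Proof. by case: x => i j; rewrite /shift; unfold_step; split_ifs; lia. Qed.

Lemma shiftK x : inside m n x -> unshift (shift x) = x.
Proof.
by case: x => i j; rewrite /shift /unshift; unfold_step; split_ifs; pair_lia.
Qed.

Lemma inside_raise x : inside m n x -> inside m n (raise x).
Proof. by case: x => i j; rewrite /raise; unfold_step; split_ifs; lia. Qed.

Lemma raiseK x : inside m n x -> ((raise x).1, sub2 n (raise x).2) = x.
Proof. by case: x => i j; rewrite /raise; unfold_step; split_ifs; pair_lia. Qed.

Lemma inside_turn x : inside m n x -> inside m n (turn x).
Proof. by case: x => i j; rewrite /turn; unfold_step; split_ifs; lia. Qed.

Lemma turnK x : inside m n x -> turn (turn x) = x.
Proof. by case: x => i j; rewrite /turn; unfold_step; split_ifs; pair_lia. Qed.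

Lemma separable_shift u v : inside m n u -> inside m n v ->
  separable m n (shift u) (shift v) -> separable m n u v.
Proof.
move=> uV vV [M sM]; exists (id \o M \o shift).
apply: (separates_transport (g' := unshift)) sM => //.
- exact: inside_shift.
- by case=> i j; rewrite /unshift; unfold_step; split_ifs; lia.
- exact: shiftK.
- by case=> i j; rewrite /shift /unshift; unfold_step; split_ifs; pair_lia.
case=> i j [[]|]; rewrite /shift; unfold_step; split_ifs; pair_lia.
Qed.

Lemma separable_raise u v : inside m n u -> inside m n v ->
  separable m n (raise u) (raise v) -> separable m n u v.
Proof.
move=> uV vV [M sM]; exists (id \o M \o raise).
apply: (separates_transport (g' := fun x => (x.1, sub2 n x.2))) sM => //.
- exact: inside_raise.
- by case=> i j; unfold_step; split_ifs; lia.
- exact: raiseK.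
- by case=> i j; rewrite /raise; unfold_step; split_ifs; pair_lia.
case=> i j [[]|]; rewrite /raise; unfold_step; split_ifs; pair_lia.
Qed.

Lemma separable_turn u v : inside m n u -> inside m n v ->
  separable m n (turn u) (turn v) -> separable m n u v.
Proof.
move=> uV vV [M sM]; exists (flip \o M \o turn).
apply: (separates_transport (g' := turn)) sM => //.
- by case=> [[]|].
- exact: inside_turn.
- exact: inside_turn.
- exact: turnK.
- exact: turnK.
case=> i j [[]|]; rewrite /turn; unfold_step; split_ifs; pair_lia.
Qed.

End Steps.

(** * Moving vertices to chosen positions by automorphisms *)

Section Normalize.
Variables m n : nat.
Hypotheses (m_gt1 : 2 <= m) (em : ~~ odd m) (n_gt3 : 4 <= n) (en : ~~ odd n).

Lemma iter_shift_column k x : inside m n x -> k <= m ->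
  inside m n (iter k (shift m n) x) /\
  (iter k (shift m n) x).1 = if x.1 + k < m then x.1 + k else x.1 + k - m.
Proof.
move=> xV; elim: k => [_|k IH km] /=.
  by split=> //; move: xV; rewrite /inside; case: x => i j /=; split_ifs; lia.
have [yV E] := IH (ltnW km).
split; first exact: inside_shift.
rewrite {1}/shift E; move: xV; rewrite /inside; split_ifs; lia.
Qed.

Lemma separable_iter_shift k u v : inside m n u -> inside m n v -> k <= m ->
  separable m n (iter k (shift m n) u) (iter k (shift m n) v) ->
  separable m n u v.
Proof.
move=> uV vV; elim: k => //= k IH km s.
have [uV' _] := iter_shift_column uV (ltnW km).
have [vV' _] := iter_shift_column vV (ltnW km).
by apply: IH; [lia | exact: separable_shift s].
Qed.

Lemma iter_shift_neq k u v : inside m n u -> inside m n v -> u != v ->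
  iter k (shift m n) u != iter k (shift m n) v.
Proof.
move=> uV vV uv; elim: k => //= k; apply: contra_neq => /(congr1 (unshift m n)).
have iV x : inside m n x -> inside m n (iter k (shift m n) x).
  by move=> xV; elim: k => //= k; exact: inside_shift.
by rewrite !shiftK ?iV.
Qed.

Lemma separable_columns : 6 <= m ->
  (forall u v, inside m n u -> inside m n v -> u != v ->
     u.1.+2 < m -> v.1.+2 < m -> separable m n u v) ->
  forall u v, inside m n u -> inside m n v -> u != v -> separable m n u v.
Proof.
move=> m6 sep u v uV vV uv.
(* One of the two vertices is rotated to column 0. If the distance from it rightwards to the other
   is at least [m - 2], the distance the other way round is at most 2, hence below [m - 2]. *)
have [k km [uk vk]] : exists2 k, k <= m &
    (if u.1 + k < m then u.1 + k else u.1 + k - m).+2 < m /\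
    (if v.1 + k < m then v.1 + k else v.1 + k - m).+2 < m.
  move: uV vV; rewrite /inside => /andP[um _] /andP[vm _].
  have [uv1|uv1] := leqP u.1 v.1.
    have [?|?] := ltnP (v.1 - u.1).+2 m.
      by exists (m - u.1); [lia | split; split_ifs; lia].
    by exists (m - v.1); [lia | split; split_ifs; lia].
  have [?|?] := ltnP (u.1 - v.1).+2 m.
    by exists (m - v.1); [lia | split; split_ifs; lia].
  by exists (m - u.1); [lia | split; split_ifs; lia].
have [uV' uE] := iter_shift_column uV km; have [vV' vE] := iter_shift_column vV km.
apply: (separable_iter_shift uV vV km); apply: sep; rewrite ?uE ?vE //.
exact: iter_shift_neq.
Qed.

Definition separable_from u :=
  forall v, inside m n v -> v != u -> separable m n u v.

Lemma separable_from_transport g g' u :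
  (forall x, inside m n x -> inside m n (g x)) ->
  (forall x, inside m n x -> g' (g x) = x) ->
  (forall v, inside m n v -> separable m n (g u) (g v) -> separable m n u v) ->
  inside m n u -> separable_from (g u) -> separable_from u.
Proof.
move=> gV gK gs uV su v vV vu; apply: gs => //; apply: su; first exact: gV.
by apply: contra_neq vu => /(congr1 g'); rewrite !gK.
Qed.

(** Iterating [shift] brings a vertex with even coordinate sum to column 0, iterating [raise] then
    brings its row around to 0, and [turn] reduces odd sums to even ones. *)
Lemma separable_from_origin : separable_from (0, 0) ->
  forall u, inside m n u -> separable_from u.
Proof.
move=> s0.
have raising j : ~~ odd j -> j < n -> separable_from (0, j).
  elim: {j}(n - j) {-2}j (leqnn (n - j)) => [|k IH] j jk oj jn; first lia.
  apply: (separable_from_transport (g := raise n)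
            (g' := fun x => (x.1, sub2 n x.2))) => //.
  - by move=> x; apply: inside_raise.
  - exact: raiseK.
  - by move=> v vV; apply: separable_raise => //; rewrite /inside /=; lia.
  - by rewrite /inside /=; lia.
  rewrite /raise /add2 /=; case: ifP => jn2; first by apply: IH; lia.
  by have ->: j.+2 - n = 0 by lia.
have shifting i j : ~~ odd (i + j) -> i < m -> j < n -> separable_from (i, j).
  elim: {i}(m - i) {-2}i (leqnn (m - i)) j => [|k IH] i ik j oij im jn; first lia.
  have [i0|i0] := posnP i; first by rewrite i0; apply: raising => //; lia.
  have xV : inside m n (i, j) by rewrite /inside /= im jn.
  apply: (separable_from_transport (g := shift m n) (g' := unshift m n)) => //.
  - by move=> x; apply: inside_shift.
  - exact: shiftK.
  - by move=> v vV; apply: separable_shift.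
  have := inside_shift m_gt1 em n_gt3 en xV.
  rewrite /shift /incr /add2 /inside /=; case: ifP => im1 /=.
    by move=> /andP[? ?]; apply: IH => //; split_ifs; lia.
  by move=> /andP[? ?]; apply: raising => //; split_ifs; lia.
case=> i j xV; case o: (odd (i + j)); last first.
  by move: xV => /andP[/= ? ?]; apply: shifting => //; rewrite o.
apply: (separable_from_transport (g := turn m n) (g' := turn m n)) => //.
- by move=> x; apply: inside_turn.
- exact: turnK.
- by move=> v vV; apply: separable_turn.
move: xV; rewrite /turn /inside /= => xV; apply: shifting; split_ifs; lia.
Qed.

End Normalize.

(** * Appending two columns *)

Section AddColumns.
Variables m n : nat.
Hypotheses (m_gt2 : 2 < m) (em : ~~ odd m) (n_gt3 : 4 <= n) (en : ~~ odd n).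
Variables (M : vertex -> dir) (u v : vertex).
Hypotheses (uV : inside m n u) (vV : inside m n v).
Hypothesis sep : separates m n M u v.

Let m_gt1 : 2 <= m := ltnW m_gt2.
Let MM : matched m n M. Proof. by case: sep. Qed.

(* The jump edge from row [j] belongs to the 2-factor. *)
Definition used j := ~~ odd j && (M (m.-1, j) != Fl).

Lemma used_incr j : j < n -> used j -> ~~ used (incr n j).
Proof.
move=> jn /andP[oj _]; apply/negP => /andP[]; rewrite /incr.
by case: ifP => ?; nat_lia.
Qed.

(** Without used jump edges the even rows of the last column are labelled [Fl], so the odd rows
    there have no vertical partner and are [Fl] too; this spreads leftwards to all columns. Each
    column would then be a cycle of its own, and [u] and [v] meet only two of at least three. *)
Lemma exists_used : exists2 j, j < n & used j.
Proof.
have [/hasP[j]|/hasPn unused] := boolP (has used (iota 0 n)).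
  by rewrite mem_iota => /andP[_ jn] uj; exists j.
have last_odd j : j < n -> ~~ odd j -> M (m.-1, j) = Fl.
  move=> jn oj; apply/eqP; have := unused j; rewrite mem_iota /used oj negbK.
  exact.
have full i : i < m -> (forall j, j < n -> odd (i + j) -> M (i, j) = Fl) ->
    forall j, j < n -> M (i, j) = Fl.
  move=> im Fi j jn; case o: (odd (i + j)); first exact: Fi.
  have xV : inside m n (i, j) by rewrite /inside /= im.
  case E: (M (i, j)) => [b|] //.
  have := MM (Some b) xV; rewrite E eqxx; case: b {E}; rewrite /step /= Fi //;
    rewrite /incr /decr; split_ifs; nat_lia.
have allFl k i j : i + k = m.-1 -> j < n -> M (i, j) = Fl.
  elim: k => [|k IH] in i j *; move=> ik jn; apply: full; try nat_lia.
    by move=> l ln o; have ->: i = m.-1 by [nat_lia]; apply: last_odd; nat_lia.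
  move=> l ln o; apply/eqP; have := @MM (i, l) Fl.
  rewrite /inside /step /= o; case: ifP => [_|]; last nat_lia.
  have -> : M (i.+1, l) = Fl by apply: IH; nat_lia.
  by rewrite eqxx; move=> <- //; nat_lia.
have {allFl}Fl_all x : inside m n x -> M x = Fl.
  by case: x => i j /andP[/= im jn]; apply: (allFl (m.-1 - i)); nat_lia.
case: sep => _ _ R.
have {R}R := R (fun x => (x.1 == u.1) || (x.1 == v.1)).
have cR : constant_along m n M (fun x => (x.1 == u.1) || (x.1 == v.1)).
  by move=> x [b|] xV; rewrite Fl_all //= => _; case: b.
have {}R i : i < m -> (i == u.1) || (i == v.1).
  move=> im; apply: (R cR _ _ (i, 0)); rewrite ?eqxx ?orbT //.
  by rewrite /inside /=; nat_lia.
by have := R 0; have := R 1; have := R 2; nat_lia.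
Qed.

(* The last used row met when going down cyclically from [j]; the vertices of row
   [j] in the two new columns lie on the path replacing its jump edge. *)
Definition own j := last 0 (filter used (iota 0 n ++ iota 0 j.+1)).

Lemma own_used j : used j -> own j = j.
Proof.
move=> uj; rewrite /own -addn1 iotaD filter_cat filter_cat /= add0n uj catA.
by rewrite last_cat.
Qed.

Lemma own_incr j : j < n -> ~~ used (incr n j) -> own (incr n j) = own j.
Proof.
rewrite /own /incr; case: ifP => [jn1 _|jn1 jn] uj.
  rewrite -(addn1 j.+1) iotaD filter_cat [in RHS]filter_cat filter_cat /= add0n.
  by rewrite (negPf uj) cats0.
have ->: j.+1 = n by nat_lia.
rewrite filter_cat [in RHS]filter_cat /= (negPf uj) cats0 last_cat.
by case: (filter used (iota 0 n)).
Qed.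

Lemma incr_ltn j : j < n -> incr n j < n.
Proof. by rewrite /incr; split_ifs; nat_lia. Qed.

Lemma iter_incr i j : i < n -> j < n -> exists k, iter k (incr n) i = j.
Proof.
have addk k a : a + k < n -> iter k (incr n) a = a + k.
  elim: k => [|k IH] ak /=; first by rewrite addn0.
  by rewrite IH /incr; [split_ifs; nat_lia | nat_lia].
have up a b : a <= b -> b < n -> exists k, iter k (incr n) a = b.
  by move=> ab bn; exists (b - a); rewrite addk ?subnKC.
move=> iN jN; have [ij|ij] := leqP i j; first exact: up.
have [k E] : exists k, iter k (incr n) i = n.-1 by apply: up; nat_lia.
have [l E'] : exists l, iter l (incr n) 0 = j by apply: up; nat_lia.
exists (l + k.+1); rewrite iterD /= E -{}E'; congr iter.
by rewrite /incr; split_ifs; nat_lia.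
Qed.

(** Every row is reached by climbing cyclically from a used row, which exists by [exists_used]; each
    used row on the way restarts the induction. *)
Lemma row_ind_up (Q : nat -> Prop) :
  (forall j, j < n -> used j -> Q j) ->
  (forall j, j < n -> ~~ used (incr n j) -> Q j -> Q (incr n j)) ->
  forall j, j < n -> Q j.
Proof.
move=> Q0 QS j jn; have [i iN ui] := exists_used.
have [k <-] := iter_incr iN jn.
suff: iter k (incr n) i < n /\ Q (iter k (incr n) i) by case.
elim: k => [|k [kn Qk]] /=; first by split=> //; exact: Q0.
have kn' := incr_ltn kn.
split=> //; have [uk|uk] := boolP (used (incr n (iter k (incr n) i))).
  exact: Q0.
exact: QS.
Qed.

(** The counterpart for the second new column: the descent starts just below a used row, where the
    replacement path crosses over. *)
Lemma row_ind_down (Q : nat -> Prop) :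
  (forall j, j < n -> used (incr n j) -> Q j) ->
  (forall j, j < n -> ~~ used (incr n j) -> Q (incr n j) -> Q j) ->
  forall j, j < n -> Q j.
Proof.
move=> Q0 QS j jn; have [i iN ui] := exists_used.
have jn' := incr_ltn jn.
have [k] := iter_incr jn' iN.
elim: k => [|k IH] /= in j jn jn' *; first by move=> ij; apply: Q0; rewrite ?ij.
have [uk|uk] := boolP (used (incr n j)); first by move=> _; exact: Q0.
rewrite -iterS iterSr => E; apply: QS => //; apply: IH => //; exact: incr_ltn.
Qed.

Lemma own_ltn j : j < n -> own j < n /\ used (own j).
Proof.
move: j; apply: row_ind_up => [j jn uj|j jn uj]; first by rewrite own_used.
by rewrite own_incr.
Qed.

(** Replacement paths are cut from each other by omitting, in both new columns, the vertical edge
    that leads up into a used row. *)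
Definition add_columns (x : vertex) : dir :=
  if x.1 < m then M x
  else if used x.2 then Dn else if used (incr n x.2) then Up else Fl.

Lemma matched_add_columns : matched m.+2 n add_columns.
Proof.
apply: matchedP; try nat_lia.
- case=> i j; rewrite /add_columns /inside /step /= => /andP[im jn].
  case: ifP => im'; first by have := @MM (i, j) Up; rewrite /inside /= im'; apply.
  have [uj|uj] := boolP (used (incr n j)).
    by case: ifP => // /(used_incr jn); rewrite uj.
  by case: ifP => // _; case: ifP.
case=> i j; rewrite /add_columns /inside /step /= => /andP[im jn] o.
rewrite o; have [im1|im1] := ltnP i.+1 m.
  have -> /= : i.+1 < m.+2 by nat_lia.
  rewrite im1 (ltnW im1); have := @MM (i, j) Fl.
  by rewrite /inside /step /= o im1; apply; nat_lia.
have end_row : ~~ odd j -> (if used j then Dn else if used (incr n j) then Up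
    else Fl) == Fl = (M (m.-1, j) == Fl).
  move=> oj; rewrite {1}/used oj; case: (M _ =P Fl) => //= _.
  by case: ifP => // /andP[]; rewrite /incr; case: ifP => ?; nat_lia.
have [Ei|im2] := eqVneq i.+1 m.
  have [-> -> ->] : [/\ i.+1 < m.+2, i < m & i.+1 = m] by split; nat_lia.
  have -> /= : i = m.-1 by nat_lia.
  by rewrite ltnn; apply: end_row; nat_lia.
have -> /= : i < m = false by nat_lia.
have [->|im3] := eqVneq i m.
  by have [-> /= ->] : m.+1 < m.+2 /\ m.+1 < m = false by split; nat_lia.
have -> /= : i.+1 < m.+2 = false by nat_lia.
have -> : 0 < m by nat_lia.
rewrite end_row; last nat_lia.
have := @MM (m.-1, j) Fl; rewrite /inside /step /=.
have -> : odd (m.-1 + j) by nat_lia.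
by have -> : m.-1.+1 < m = false by [nat_lia]; apply; nat_lia.
Qed.

Definition color_columns (X : pred vertex) (x : vertex) : bool :=
  if x.1 < m then X x else X (m.-1, own x.2).

Lemma constant_color_columns X :
  constant_along m n M X -> constant_along m.+2 n add_columns (color_columns X).
Proof.
move=> cX; apply: constant_alongP; try nat_lia; first exact: matched_add_columns.
- case=> i j; rewrite /color_columns /add_columns /inside /step /= => /andP[im jn].
  case: ifP => im' Mij.
    by have := cX (i, j) Up; rewrite /inside /= im'; apply.
  congr X; congr pair; apply: own_incr => //; apply/negP => uj.
  by case: ifP Mij => [/(used_incr jn)|_]; rewrite uj.
case=> i j; rewrite /color_columns /add_columns /inside /step /= => /andP[im jn] o.
rewrite o; have [im1|im1] := ltnP i.+1 m.
  have -> /= : i.+1 < m.+2 by nat_lia.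
  rewrite im1 (ltnW im1) => Mij; have := cX (i, j) Fl.
  by rewrite /inside /step /= o im1; apply; first nat_lia.
have end_row : ~~ odd j -> (if used j then Dn else if used (incr n j) then Up
    else Fl) != Fl -> used j.
  move=> oj; do 2 case: ifP => //.
  by move=> /andP[]; rewrite /incr; case: ifP => ?; nat_lia.
have [Ei|im2] := eqVneq i.+1 m.
  have [-> -> ->] : [/\ i.+1 < m.+2, i < m & i.+1 = m] by split; nat_lia.
  have -> /= : i = m.-1 by nat_lia.
  by rewrite ltnn => Mj; rewrite own_used // /used Mj; nat_lia.
have -> /= : i < m = false by nat_lia.
have [->|im3] := eqVneq i m.
  by have [-> /= ->] : m.+1 < m.+2 /\ m.+1 < m = false by split; nat_lia.
have -> /= : i.+1 < m.+2 = false by nat_lia.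
have -> : 0 < m by nat_lia.
move=> /end_row uj; have {}uj : used j by apply: uj; nat_lia.
rewrite own_used //; case/andP: uj => _.
have := cX (m.-1, j) Fl; rewrite /inside /step /=.
have -> : odd (m.-1 + j) by nat_lia.
by have -> : m.-1.+1 < m = false by [nat_lia]; apply; nat_lia.
Qed.

(** The value of [P] is carried along each replacement path, up column [m], across, and down column
    [m.+1]. On the old columns [P] therefore respects the replaced jump edges, so it holds there,
    and [own] passes it on to the new columns. *)
Lemma reached_add_columns P : constant_along m.+2 n add_columns P -> P u -> P v ->
  forall x, inside m.+2 n x -> P x.
Proof.
move=> cP Pu Pv.
have up i j : i = m \/ i = m.+1 -> j < n -> ~~ used (incr n j) ->
    P (i, incr n j) = P (i, j).
  move=> im jn uj; have := cP (i, j) Up; rewrite /inside /step /=; apply; first nat_lia.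
  rewrite /add_columns /=; case: ifP => ?; first nat_lia.
  by case: ifP => // _; rewrite (negPf uj).
have left_end j : j < n -> used j -> P (m, j) = P (m.-1, j).
  move=> jn /andP[oj Mj]; have := cP (m.-1, j) Fl; rewrite /inside /step /=.
  have [-> ->] : odd (m.-1 + j) /\ m.-1.+1 = m by split; nat_lia.
  have -> : m < m.+2 by nat_lia.
  by apply; [nat_lia | rewrite /add_columns /= ifT //; nat_lia].
have right_end j : j < n -> used j -> P (0, add2 n j) = P (m.+1, j).
  move=> jn uj; have /andP[oj Mj] := uj; have := cP (m.+1, j) Fl.
  rewrite /inside /step /=.
  have [-> ->] : ~~ odd (m + j) /\ m.+2 < m.+2 = false by split; nat_lia.
  by apply; [nat_lia | rewrite /add_columns /= uj ifF //; nat_lia].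
have cross j : j < n -> used (incr n j) -> P (m.+1, j) = P (m, j).
  move=> jn uj; have := cP (m, j) Fl; rewrite /inside /step /=.
  have oj : odd j by case/andP: uj; rewrite /incr; case: ifP => ?; nat_lia.
  have [-> ->] : odd (m + j) /\ m.+1 < m.+2 by split; nat_lia.
  by apply; [nat_lia | rewrite /add_columns /= uj ltnn /used oj].
have left j : j < n -> P (m, j) = P (m.-1, own j).
  move: j; apply: row_ind_up => j jn uj; first by rewrite own_used ?left_end.
  by rewrite own_incr ?up //; left.
have right j : j < n -> P (m.+1, j) = P (m.-1, own j).
  move: j; apply: row_ind_down => j jn uj; first by rewrite cross ?left.
  by rewrite own_incr ?up //; right.
have cP' : constant_along m n M P.
  apply: (constant_alongP m_gt1 em n_gt3 en MM).
    case=> i j /andP[/= im jn] Mij; apply: (cP (i, j) Up); rewrite ?/inside /=.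
      by nat_lia.
    by rewrite /add_columns im.
  case=> i j /andP[/= im jn] o Mij; rewrite /step /= o; case: ifP => im1.
    have := cP (i, j) Fl; rewrite /inside /step /= o.
    have -> : i.+1 < m.+2 by nat_lia.
    by apply; [nat_lia | rewrite /add_columns im].
  have Ei : i = m.-1 by nat_lia.
  have uj : used j by rewrite /used -Ei Mij; nat_lia.
  by rewrite right_end // right // own_used // Ei.
case: sep => _ _ R; have {}R := R P cP' Pu Pv.
have Pown j : j < n -> P (m.-1, own j).
  by move=> jn; apply: R; have [] := own_ltn jn; rewrite /inside /=; nat_lia.
case=> i j /andP[/= im jn]; have [im'|im'] := ltnP i m.
  by apply: R; rewrite /inside /= im'.
have [->|->] : i = m \/ i = m.+1 by nat_lia.
  by rewrite left ?Pown.
by rewrite right ?Pown.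
Qed.

Lemma separates_add_columns : separates m.+2 n add_columns u v.
Proof.
case: (sep) => _ [X [cX Xu Xv]] _; split; first exact: matched_add_columns.
  exists (color_columns X); rewrite /color_columns.
  move: uV vV => /andP[-> _] /andP[-> _]; split=> //.
  exact: constant_color_columns.
by move=> P cP Pu Pv; apply: reached_add_columns.
Qed.

End AddColumns.

(** * Inserting two rows at a seam *)

(* The last condition concerns the only jump edge passing from below row [h] to row
   [h] or above. *)
Definition seam m n (M : vertex -> dir) h :=
  [&& 0 < h, h < n, all (fun i => M (i, h.-1) != Up) (iota 0 m)
    & M (m.-1, if odd h then h.-1 else h - 2) == Fl].

Definition add_rows h (M : vertex -> dir) (x : vertex) : dir :=
  if x.2 < h then M x else if x.2 < h.+2 then Fl else M (x.1, x.2 - 2).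

Lemma incr_lt n j : j.+1 < n -> incr n j = j.+1.
Proof. by rewrite /incr => ->. Qed.

Lemma incr_last n j : n <= j.+1 -> incr n j = 0.
Proof. by rewrite /incr ltnNge => ->. Qed.

Lemma add2_lt n j : j.+2 < n -> add2 n j = j.+2.
Proof. by rewrite /add2 => ->. Qed.

Lemma add2_ge n j : n <= j.+2 -> add2 n j = j.+2 - n.
Proof. by rewrite /add2 ltnNge => ->. Qed.

Definition lift_row h (x : vertex) : vertex :=
  (x.1, if x.2 < h then x.2 else x.2.+2).

Section AddRows.
Variables m n : nat.
Hypotheses (m_gt1 : 2 <= m) (em : ~~ odd m) (n_gt3 : 4 <= n) (en : ~~ odd n).
Variables (M : vertex -> dir) (u v : vertex).
Hypothesis sep : separates m n M u v.
Variable h : nat.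
Hypothesis sM : seam m n M h.

Let MM : matched m n M. Proof. by case: sep. Qed.
Let h_gt0 : 0 < h. Proof. by case/and4P: sM. Qed.
Let h_ltn : h < n. Proof. by case/and4P: sM. Qed.

Let n2_gt3 : 4 <= n.+2. Proof. by rewrite ltnW // ltnW. Qed.
Let en2 : ~~ odd n.+2. Proof. by rewrite /= negbK. Qed.

Lemma seam_up i j : i < m -> j.+1 = h -> M (i, j) != Up.
Proof.
move=> im jh; case/and4P: sM => _ _ /allP up _.
by have := up i; rewrite -jh mem_iota; apply.
Qed.

Lemma seam_down i : i < m -> M (i, h) != Dn.
Proof.
move=> im; have := @MM (i, h.-1) Up; rewrite /inside /step /incr /=.
rewrite prednK // h_ltn => -> //; last nat_lia.
by apply: seam_up; nat_lia.
Qed.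

Lemma seam_jump j : ~~ odd j -> j < h -> h <= j.+2 -> M (m.-1, j) = Fl.
Proof.
move=> oj jh hj; case/and4P: sM => _ _ _ /eqP <-.
by congr (M (_, _)); case: ifP => ?; nat_lia.
Qed.

Lemma seam_landing j : ~~ odd j -> j < h -> h <= j.+2 ->
  M (0, add2 n j) = Fl.
Proof.
move=> oj jh hj; have := @MM (m.-1, j) Fl; rewrite seam_jump // /inside /step /=.
have [-> ->] : odd (m.-1 + j) /\ m.-1.+1 < m = false by split; nat_lia.
by move=> /(_ _)/eqP; apply; nat_lia.
Qed.

Lemma matched_add_rows : matched m n.+2 (add_rows h M).
Proof.
apply: (matchedP m_gt1 em n2_gt3 en2).
- case=> i j; rewrite /add_rows /inside /step /= => /andP[im jn].
  have up l : l < n -> (M (i, incr n l) == Dn) = (M (i, l) == Up).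
    by move=> ln; have := @MM (i, l) Up; rewrite /inside /step /= im ln; apply.
  have [jh|jh] := ltnP j.+1 h.
    have ijn : incr n.+2 j = j.+1 by rewrite /incr; case: ifP; nat_lia.
    rewrite ijn jh (ltnW jh) -up; last nat_lia.
    by rewrite /incr; case: ifP => ?; [|nat_lia].
  have [jh'|jh'] := ltnP j h.
    have -> : incr n.+2 j = h by rewrite /incr; case: ifP; nat_lia.
    by rewrite ltnn ltnW // (negPf (seam_up im _)) //; nat_lia.
  have [jh2|jh2] := ltnP j h.+1.
    have -> : incr n.+2 j = h.+1 by rewrite /incr; case: ifP; nat_lia.
    have -> : j = h by nat_lia.
    by rewrite ltnNge leqnSn ltnSn ltnW.
  have [jh3|jh3] := ltnP j h.+2.
    have -> : incr n.+2 j = h.+2 by rewrite /incr; case: ifP; nat_lia.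
    rewrite ltnNge ltnW ?leqnSn // ltnn.
    by have -> : h.+2 - 2 = h by [nat_lia]; rewrite (negPf (seam_down im)).
  rewrite -up; last nat_lia.
  have [jn2|jn2] := ltnP j.+1 n.+2.
    rewrite !incr_lt; try nat_lia.
    have [-> ->] : j.+1 < h = false /\ j.+1 < h.+2 = false by split; nat_lia.
    by have -> : j.+1 - 2 = (j - 2).+1 by nat_lia.
  by rewrite !incr_last ?h_gt0; try nat_lia.
case=> i j; rewrite /inside /= => /andP[im jn] o; rewrite /step /= o.
case: ifP => im1.
  have fl l : l < n -> odd (i + l) -> (M (i.+1, l) == Fl) = (M (i, l) == Fl).
    move=> ln ol; have := @MM (i, l) Fl; rewrite /inside /step /= im ln ol im1.
    exact.
  rewrite /add_rows /=; case: ifP => jh; first by apply: fl; nat_lia.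
  by case: ifP => jh2 //; apply: fl; nat_lia.
have Ei : i = m.-1 by nat_lia.
have fl l : l < n -> ~~ odd l -> (M (0, add2 n l) == Fl) = (M (i, l) == Fl).
  move=> ln ol; have := @MM (i, l) Fl; rewrite /inside /step /= im ln im1.
  by have -> : odd (i + l) by [nat_lia]; apply.
have oj : ~~ odd j by nat_lia.
rewrite /add_rows /=; have [jh|jh] := ltnP j h.
  have -> : add2 n.+2 j = j.+2 by rewrite /add2; case: ifP; nat_lia.
  have [jh2|jh2] := ltnP j.+2 h.
    have := fl j; rewrite /add2; case: ifP => ?; last nat_lia.
    by apply; nat_lia.
  rewrite Ei seam_jump //; case: ifP => //; nat_lia.
have [jh2|jh2] := ltnP j h.+2.
  (* The jump edge out of the even new row lands where the old jump edge across the seam, from row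
     [k], used to land; that end is labelled [Fl] already. *)
  have [k [Ek ok kh hk]] : exists k, [/\ j = k.+2, ~~ odd k, k < h & h <= k.+2].
    by exists (j - 2); split; nat_lia.
  have := seam_landing ok kh hk; have [jn2|jn2] := ltnP j.+2 n.+2.
    rewrite !add2_lt; try nat_lia.
    have [-> ->] : j.+2 < h = false /\ j.+2 < h.+2 = false by split; nat_lia.
    by have -> : j.+2 - 2 = k.+2 by [nat_lia]; move->.
  rewrite !add2_ge; try nat_lia.
  have -> : j.+2 - n.+2 < h by nat_lia.
  by have -> : j.+2 - n.+2 = k.+2 - n by [nat_lia]; move->.
rewrite -fl; [|nat_lia|nat_lia].
have [jn2|jn2] := ltnP j.+2 n.+2.
  rewrite !add2_lt; try nat_lia.
  have [-> ->] : j.+2 < h = false /\ j.+2 < h.+2 = false by split; nat_lia.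
  by have -> : (j - 2).+2 = j.+2 - 2 by nat_lia.
rewrite !add2_ge; try nat_lia.
have -> : j.+2 - n.+2 < h by nat_lia.
by have -> : (j - 2).+2 - n = j.+2 - n.+2 by nat_lia.
Qed.

Definition color_rows (X : pred vertex) (x : vertex) : bool :=
  if x.2 < h then X x else if x.2 < h.+2 then X (x.1, h) else X (x.1, x.2 - 2).

Lemma constant_color_rows X :
  constant_along m n M X -> constant_along m n.+2 (add_rows h M) (color_rows X).
Proof.
move=> cX; apply: (constant_alongP m_gt1 em n2_gt3 en2 matched_add_rows).
- case=> i j; rewrite /add_rows /color_rows /inside /step /= => /andP[im jn].
  have up l : l < n -> M (i, l) != Up -> X (i, incr n l) = X (i, l).
    by move=> ln; have := cX (i, l) Up; rewrite /inside /step /= im ln; apply.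
  have [jh|jh] := ltnP j.+1 h.
    have ijn : incr n.+2 j = j.+1 by rewrite /incr; case: ifP; nat_lia.
    rewrite ijn jh (ltnW jh) => Mj; rewrite -(up j _ Mj); last nat_lia.
    by rewrite incr_lt //; nat_lia.
  have [jh'|jh'] := ltnP j h.
    have -> : incr n.+2 j = h by rewrite /incr; case: ifP; nat_lia.
    rewrite ltnn ltnW // => Mj; rewrite -(up j _ Mj); last nat_lia.
    by rewrite incr_lt; [congr (X (_, _)) |]; nat_lia.
  have [jh2|jh2] := ltnP j h.+1.
    have -> : incr n.+2 j = h.+1 by rewrite /incr; case: ifP; nat_lia.
    have -> : j = h by nat_lia.
    have -> : h.+1 < h = false by nat_lia.
    by rewrite ltnSn ltnW.
  have [jh3|jh3] := ltnP j h.+2.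
    have -> : incr n.+2 j = h.+2 by rewrite /incr; case: ifP; nat_lia.
    have -> : h.+2 < h = false by nat_lia.
    by rewrite ltnn subn2.
  move=> Mj; rewrite -(up _ _ Mj); last nat_lia.
  have [jn2|jn2] := ltnP j.+1 n.+2.
    rewrite !incr_lt; try nat_lia.
    have [-> ->] : j.+1 < h = false /\ j.+1 < h.+2 = false by split; nat_lia.
    by have -> : j.+1 - 2 = (j - 2).+1 by nat_lia.
  by rewrite !incr_last ?h_gt0; try nat_lia.
case=> i j; rewrite /inside /= => /andP[im jn] o; rewrite /step /= o.
case: ifP => im1.
  have fl l : l < n -> odd (i + l) -> M (i, l) != Fl -> X (i.+1, l) = X (i, l).
    move=> ln ol; have := cX (i, l) Fl; rewrite /inside /step /= im ln ol im1.
    exact.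
  rewrite /add_rows /color_rows /=; case: ifP => jh; first by apply: fl; nat_lia.
  by case: ifP => jh2 //; apply: fl; nat_lia.
have Ei : i = m.-1 by nat_lia.
have fl l : l < n -> ~~ odd l -> M (i, l) != Fl -> X (0, add2 n l) = X (i, l).
  move=> ln ol; have := cX (i, l) Fl; rewrite /inside /step /= im ln im1.
  by have -> : odd (i + l) by [nat_lia]; apply.
have oj : ~~ odd j by nat_lia.
rewrite /add_rows /color_rows /=; have [jh|jh] := ltnP j h.
  have -> : add2 n.+2 j = j.+2 by rewrite /add2; case: ifP; nat_lia.
  have [jh2|jh2] := ltnP j.+2 h.
    have := fl j; rewrite /add2; case: ifP => ?; last nat_lia.
    by apply; nat_lia.
  by rewrite Ei seam_jump.
have [jh2|jh2] := ltnP j h.+2 => //.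
move=> Mj; rewrite -(fl _ _ _ Mj); [|nat_lia|nat_lia].
have [jn2|jn2] := ltnP j.+2 n.+2.
  rewrite !add2_lt; try nat_lia.
  have [-> ->] : j.+2 < h = false /\ j.+2 < h.+2 = false by split; nat_lia.
  by have -> : (j - 2).+2 = j.+2 - 2 by nat_lia.
rewrite !add2_ge; try nat_lia.
have -> : j.+2 - n.+2 < h by nat_lia.
by have -> : (j - 2).+2 - n = j.+2 - n.+2 by nat_lia.
Qed.

Lemma color_rows_lift X x : color_rows X (lift_row h x) = X x.
Proof.
case: x => i j; rewrite /color_rows /lift_row /=; have [jh|jh] := ltnP j h.
  by rewrite jh.
have [-> ->] : j.+2 < h = false /\ j.+2 < h.+2 = false by split; nat_lia.
by rewrite subn2.
Qed.

(** All vertical edges through the new rows are kept, so they carry [P] across the seam in every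
    column, and [P \o lift_row h] is constant along the old 2-factor. *)
Lemma reached_add_rows P : constant_along m n.+2 (add_rows h M) P ->
  P (lift_row h u) -> P (lift_row h v) -> forall x, inside m n.+2 x -> P x.
Proof.
move=> cP Pu Pv.
have up i j : i < m -> j < n.+2 -> add_rows h M (i, j) != Up ->
    P (i, incr n.+2 j) = P (i, j).
  move=> im jn; have := cP (i, j) Up; rewrite /inside /step /=; apply; nat_lia.
have across i j : i < m -> j.+1 = h ->
    [/\ P (i, h) = P (i, j), P (i, h.+1) = P (i, j) & P (i, h.+2) = P (i, j)].
  move=> im jh.
  have U l : j <= l -> l < h.+2 -> P (i, l.+1) = P (i, l).
    move=> jl lh; have := up i l im; rewrite incr_lt; last nat_lia.
    apply; first nat_lia.
    rewrite /add_rows /=; have [lh'|lh'] := ltnP l h; last by rewrite lh.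
    by apply: seam_up; nat_lia.
  by rewrite -jh !U //; nat_lia.
have cP' : constant_along m n M (P \o lift_row h).
  apply: (constant_alongP m_gt1 em n_gt3 en MM).
    case=> i j /andP[/= im jn] Mij; rewrite /step /lift_row /=.
    have [jh|jh] := ltnP j.+1 h.
      have -> : incr n j = j.+1 by rewrite /incr; case: ifP; nat_lia.
      have Ej : incr n.+2 j = j.+1 by rewrite /incr; case: ifP; nat_lia.
      by rewrite jh ltnW // -{1}Ej up // /add_rows /= ?(ltnW jh) //; nat_lia.
    have [jh'|jh'] := ltnP j h.
      have -> : incr n j = h by rewrite /incr; case: ifP; nat_lia.
      by rewrite ltnn; have [] := across i j im; first nat_lia.
    have := up i j.+2 im; rewrite /add_rows /=.
    have [-> ->] : j.+2 < h = false /\ j.+2 < h.+2 = false by split; nat_lia.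
    rewrite subn2 /= => <- //; congr P; congr pair.
    have [jn1|jn1] := ltnP j.+1 n; last by rewrite !incr_last ?h_gt0.
    by rewrite !incr_lt // ltnNge jh.
  case=> i j /andP[/= im jn] o Mij; rewrite /step /lift_row /= o.
  have [jh|jh] := ltnP j h.
    have := cP (i, j) Fl; rewrite /inside /step /add_rows /= o jh.
    case: ifP => im1 /= E; first by rewrite jh; apply: E => //; nat_lia.
    (* A kept jump edge starting below the seam also lands below it. *)
    have jh2 : j.+2 < h.
      rewrite ltnNge; apply/negP => hj; case/negP: Mij.
      by have -> : i = m.-1 by [nat_lia]; rewrite seam_jump //; nat_lia.
    have -> : add2 n j = add2 n.+2 j by rewrite !add2_lt //; nat_lia.
    have -> : add2 n.+2 j < h by rewrite add2_lt //; nat_lia.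
    by apply: E => //; nat_lia.
  have := cP (i, j.+2) Fl; rewrite /inside /step /add_rows /=.
  have -> : odd (i + j.+2) by nat_lia.
  have [-> ->] : j.+2 < h = false /\ j.+2 < h.+2 = false by split; nat_lia.
  rewrite subn2 /=; case: ifP => im1 /= E.
    by rewrite ltnNge jh; apply: E => //; nat_lia.
  rewrite -E //; last nat_lia.
  congr (P (_, _)); have [jn2|jn2] := ltnP j.+2 n.
    by rewrite !add2_lt //; case: ifP => // ?; nat_lia.
  by rewrite !add2_ge //; case: ifP => // ?; nat_lia.
case: sep => _ _ R; have {}R := R _ cP' Pu Pv.
case=> i j /andP[/= im jn]; have [jh|jh] := ltnP j h.
  have := R (i, j); rewrite /inside /lift_row /= jh; apply; nat_lia.
have [jh2|jh2] := ltnP j h.+2.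
  have [E1 E2 _] := across i h.-1 im (prednK h_gt0).
  have := R (i, h.-1); rewrite /inside /lift_row /= ifT; last nat_lia.
  by have [->|->] : j = h \/ j = h.+1 by [nat_lia]; rewrite ?E1 ?E2; apply; nat_lia.
have := R (i, j - 2); rewrite /inside /lift_row /= ifF; last nat_lia.
by have -> : (j - 2).+2 = j by [nat_lia]; apply; nat_lia.
Qed.

Lemma separates_add_rows :
  separates m n.+2 (add_rows h M) (lift_row h u) (lift_row h v).
Proof.
case: (sep) => _ [X [cX Xu Xv]] _; split; first exact: matched_add_rows.
  exists (color_rows X); rewrite !color_rows_lift; split=> //.
  exact: constant_color_rows.
by move=> P cP Pu Pv; apply: reached_add_rows.
Qed.

End AddRows.

(** Together with [seam_add_rows_above], this lets seams survive an insertion, so that insertions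
    can be repeated. *)
Lemma seam_add_rows m n M h h' : h' <= h -> seam m n M h' ->
  seam m n.+2 (add_rows h M) h'.
Proof.
rewrite /seam /add_rows => hh /and4P[h'0 h'n /allP up /eqP jump] /=.
apply/and4P; split; rewrite ?h'0 //; first by rewrite ltnW // ltnW.
  by apply/allP => i /up; rewrite ifT //; lia.
by rewrite ifT ?jump //; case: ifP; lia.
Qed.

Lemma seam_add_rows_above m n M h h' : h < h' -> seam m n M h' ->
  seam m n.+2 (add_rows h M) h'.+2.
Proof.
rewrite /seam /add_rows => hh /and4P[h'0 h'n /allP up /eqP jump] /=.
apply/and3P; split; rewrite // ?negbK.
  apply/allP => i /up; have -> : h'.+1 < h = false by lia.
  by case: ifP => // _; have -> : h'.+1 - 2 = h'.-1 by lia.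
case: ifP => [oh|oh] in jump *.
  have -> : h'.+1 < h = false by lia.
  by case: ifP => // _; have -> : h'.+1 - 2 = h'.-1 by [lia]; rewrite jump.
have -> : h'.+2 - 2 < h = false by lia.
by case: ifP => // ?; have -> : h'.+2 - 2 - 2 = h' - 2 by [lia]; rewrite jump.
Qed.

(** * Certified search in small graphs *)

Definition vertices m n := allpairs (@pair nat nat) (iota 0 m) (iota 0 n).

Lemma mem_vertices m n x : (x \in vertices m n) = inside m n x.
Proof.
case: x => i j; apply/allpairsP/andP => [[[a b] [/= ]]|[/= im jn]].
  by rewrite !mem_iota => ? ? [-> ->].
by exists (i, j); rewrite /= !mem_iota.
Qed.

(* The matching whose vertical edges start upwards from the vertices of [L]. *)
Definition label_of n (L : seq vertex) (x : vertex) : dir :=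
  if x \in L then Up else if (x.1, decr n x.2) \in L then Dn else Fl.

(** Follows the 2-factor, [d] being the direction of arrival: the next step avoids the omitted edge
    and the edge just used. *)
Fixpoint walk m n (M : vertex -> dir) k x d : seq vertex :=
  if k is k'.+1 then
    let good d' := (M x != d') && (flip d != d') in
    let d' := if good Up then Up else if good Dn then Dn else Fl in
    x :: walk m n M k' (step m n d' x) d'
  else [::].

Definition dirs : seq dir := [:: Up; Dn; Fl].

(** A boolean certificate: membership in [c1] is the colour required by [separates], and the two
    walks cover all vertices, which excludes a third component. [m * n] steps go round any cycle,
    and the initial [Up] merely forbids starting downwards. *)
Definition separating m n (M : vertex -> dir) u v :=
  let c1 := walk m n M (m * n) u Up in
  let c2 := walk m n M (m * n) v Up in
  [&& u \in c1, v \notin c1 &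
    all (fun x => [&& (x \in c1) || (x \in c2) &
      all (fun d => ((M (step m n d x) == flip d) == (M x == d)) &&
        ((M x != d) ==> ((step m n d x \in c1) == (x \in c1)))) dirs])
      (vertices m n)].

Section Check.
Variables m n : nat.
Hypotheses (m_gt1 : 2 <= m) (em : ~~ odd m) (n_gt3 : 4 <= n) (en : ~~ odd n).

Lemma walk_constant M P k x d : constant_along m n M P -> inside m n x -> P x ->
  {subset walk m n M k x d <= P}.
Proof.
move=> cP; elim: k x d => //= k IH x d xV Px y.
rewrite inE => /orP[/eqP->//|]; apply: IH; first exact: inside_step.
(* [Fl] is chosen only when the omitted and the forbidden directions are [Up] and [Dn], so the walk
   never takes an omitted edge. *)
rewrite cP //; case: (M x) d => [[]|] [[]|] //.
Qed.

Lemma separatingP M u v : inside m n u -> inside m n v ->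
  separating m n M u v -> separates m n M u v.
Proof.
move=> uV vV; rewrite /separating; set c1 := walk _ _ _ _ u _.
set c2 := walk _ _ _ _ v _ => /and3P[uc1 vc1 /allP ok].
have okd x d : inside m n x -> ((M (step m n d x) == flip d) == (M x == d)) &&
    ((M x != d) ==> ((step m n d x \in c1) == (x \in c1))).
  rewrite -mem_vertices => /ok/andP[_] /and4P[]; by case: d => [[]|].
split.
- by move=> x d xV; case/andP: (okd x d xV) => /eqP.
- exists (fun x => x \in c1); split=> // x d xV Mx.
  by case/andP: (okd x d xV) => _ /implyP/(_ Mx)/eqP.
move=> P cP Pu Pv x xV; move: (xV); rewrite -mem_vertices => /ok/andP[/orP[] xc _].
  exact: (walk_constant cP uV Pu xc).
exact: (walk_constant cP vV Pv xc).
Qed.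

(** Each [v] may use a different seed; [req] lets the search demand seams as well. *)
Lemma separates_by_search seeds (req : seq vertex -> vertex -> bool) :
  all (fun v => (v != (0, 0)) ==> has (fun L =>
    separating m n (label_of n L) (0, 0) v && req L v) seeds) (vertices m n) ->
  forall v, inside m n v -> v != (0, 0) ->
  exists2 L, separates m n (label_of n L) (0, 0) v & req L v.
Proof.
move=> ok v vV v0; move: (vV); rewrite -mem_vertices => /(allP ok)/implyP/(_ v0).
case/hasP=> L _ /andP[sL rL]; exists L => //; apply: separatingP => //.
by rewrite /inside /=; nat_lia.
Qed.

End Check.

Lemma separable_2_4 v : inside 2 4 v -> v != (0, 0) -> separable 2 4 (0, 0) v.
Proof.
(* Each seed splits the graph into two 4-cycles, and the three 4-cycles through the origin meet only
   there. *)
pose seeds : seq (seq vertex) :=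
  [:: [::];
      [:: (0,0); (0,2); (1,1); (1,3)];
      [:: (0,1); (0,3); (1,0); (1,2)]].
move=> vV v0.
have [|L sL _] := separates_by_search (isT : 1 < 2) isT (isT : 3 < 4) isT
  (seeds := seeds) (req := fun _ _ => true) _ vV v0; first by vm_compute.
by exists (label_of 4 L).
Qed.

Lemma separable_4_6 v : inside 4 6 v -> v != (0, 0) -> separable 4 6 (0, 0) v.
Proof.
(* Again the cycles through the origin in the three 2-factors have only the origin in common. *)
pose seeds : seq (seq vertex) :=
  [:: [:: (0,0); (0,3); (1,0); (1,2); (2,1); (2,5); (3,1); (3,4)];
      [:: (0,1); (0,5); (1,0); (1,4); (2,3); (2,5); (3,3); (3,5)];
      [:: (0,1); (0,3); (1,0); (1,2); (2,0); (2,2); (3,0); (3,2)]].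
move=> vV v0.
have [|L sL _] := separates_by_search (isT : 1 < 4) isT (isT : 3 < 6) isT
  (seeds := seeds) (req := fun _ _ => true) _ vV v0; first by vm_compute.
by exists (label_of 6 L).
Qed.

(** * Growing [n] at [m = 4], then growing [m] *)

(* Seams on either side of [v], as long as there is room for them, allow to grow
   [n] while keeping [v] at any prescribed height. *)
Definition stretchable n v := exists M, [/\ separates 4 n M (0, 0) v,
  v.2 + 4 <= n -> exists2 h, v.2 < h & seam 4 n M h
  & 2 < v.2 -> exists2 h, h <= v.2 & seam 4 n M h].

Lemma stretchable_8 v : inside 4 8 v -> v != (0, 0) -> stretchable 8 v.
Proof.
pose seeds : seq (seq vertex) :=
  [:: [:: (0,2); (0,7); (1,2); (1,6); (2,1); (2,5); (3,0); (3,5)];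
      [:: (0,1); (0,6); (1,1); (1,6); (2,1); (2,5); (3,0); (3,4)];
      [:: (0,0); (0,2); (1,0); (1,2); (2,1); (2,7); (3,0); (3,6)]].
pose has_seam L P := has (fun h => P h && seam 4 8 (label_of 8 L) h) (iota 0 8).
pose req L (v : vertex) := ((v.2 + 4 <= 8) ==> has_seam L (fun h => v.2 < h)) &&
  ((2 < v.2) ==> has_seam L (fun h => h <= v.2)).
move=> vV v0.
have [|L sL /andP[/implyP above /implyP below]] := separates_by_search
  (isT : 1 < 4) isT (isT : 3 < 8) isT (seeds := seeds) (req := req) _ vV v0.
  by vm_compute.
exists (label_of 8 L); split=> //.
- by move/above/hasP => [h _ /andP[? ?]]; exists h.
- by move/below/hasP => [h _ /andP[? ?]]; exists h.
Qed.

Lemma stretchable_ge8 n v : ~~ odd n -> 8 <= n -> inside 4 n v -> v != (0, 0) ->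
  stretchable n v.
Proof.
move=> en n8; have -> : n = (n - 8)./2.*2 + 8 by rewrite even_halfK; nat_lia.
elim: (n - 8)./2 v => {n en n8} [|k IH] [i j] vV v0; first exact: stretchable_8.
move: IH; rewrite doubleS !addSn; set n := k.*2 + 8 => IH.
have [n4 en] : 4 <= n /\ ~~ odd n by split; rewrite /n; nat_lia.
have n8 : 8 <= n by rewrite /n; nat_lia.
move: vV; rewrite /inside /= => /andP[i4 jn2].
(* With room above [v] the new rows go above it. Otherwise [v] comes from the vertex two rows lower,
   which is high enough to have a seam at or below it, and the rows go there. *)
have [jn|jn] := leqP (j + 4) n.
  have vV' : inside 4 n (i, j) by rewrite /inside /=; nat_lia.
  have [M [sM /(_ jn)[h /= jh hM] below]] := IH (i, j) vV' v0.
  exists (add_rows h M); have h0 : 0 < h by case/andP: hM.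
  have := separates_add_rows (isT : 2 <= 4) isT n4 en sM hM.
  rewrite /lift_row /= h0 jh => s'; split=> //= [_|j2].
    by exists h => //; apply: seam_add_rows.
  have [h' /= h'j h'M] := below j2.
  by exists h' => //; apply: seam_add_rows => //; nat_lia.
have vV' : inside 4 n (i, j - 2) by rewrite /inside /=; nat_lia.
have v0' : (i, j - 2) != (0, 0) by rewrite xpair_eqE; nat_lia.
have [M [sM above below]] := IH (i, j - 2) vV' v0'.
have [|h /= hj hM] := below; first by rewrite /=; nat_lia.
exists (add_rows h M); have h0 : 0 < h by case/andP: hM.
have := separates_add_rows (isT : 2 <= 4) isT n4 en sM hM.
rewrite /lift_row /= h0 ltnNge hj /=.
have -> : (j - 2).+2 = j by nat_lia.
move=> s'; split=> //= [jn4|j2].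
  have [|h' /= jh' h'M] := above; first by rewrite /=; nat_lia.
  exists h'.+2; first nat_lia.
  by apply: seam_add_rows_above => //; nat_lia.
by exists h; [nat_lia | apply: seam_add_rows].
Qed.

(** At [m = 4] one of the vertices may be taken to be the origin. Then [m] grows by two columns at a
    time, the pair having been rotated out of the last two. *)
Lemma separable_grow m n : 4 <= m -> ~~ odd m -> 6 <= n -> ~~ odd n ->
  forall u v, inside m n u -> inside m n v -> u != v -> separable m n u v.
Proof.
move=> m4 em n6 en; have n4 : 4 <= n by apply: leq_trans n6.
have -> : m = (m - 4)./2.*2 + 4 by rewrite even_halfK; nat_lia.
elim: (m - 4)./2 => {m m4 em} [|k IH].
  move=> u v uV vV uv.
  apply: (separable_from_origin _ _ _ _ _ uV vV) => //; last by rewrite eq_sym.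
  move=> {u v uV vV uv} v vV v0; have [n8|n8] := leqP 8 n.
    by have [M [sM _ _]] := stretchable_ge8 en n8 vV v0; exists M.
  have n6' : n = 6 by nat_lia.
  by move: vV; rewrite n6' => vV; apply: separable_4_6.
rewrite doubleS !addSn; move: IH; set m := k.*2 + 4 => IH.
have [m4 em] : 4 <= m /\ ~~ odd m by split; rewrite /m; nat_lia.
apply: separable_columns => //; try nat_lia.
move=> [i j] [i' j'] /andP[/= _ jn] /andP[/= _ jn'] uv im im'.
have uV : inside m n (i, j) by rewrite /inside /=; nat_lia.
have vV : inside m n (i', j') by rewrite /inside /=; nat_lia.
have [M sM] := IH _ _ uV vV uv; exists (add_columns m n M).
by apply: separates_add_columns => //; nat_lia.
Qed.

(** * Cycles in 2-regular graphs *)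

Section TwoRegular.
Variables (T : finType) (F : rel T).
Hypotheses (symF : symmetric F) (irrF : irreflexive F).
Hypothesis valF : forall x, valency F x = 2.

Lemma two_neighbours x a b c : F x a -> F x b -> a != b -> F x c ->
  c = a \/ c = b.
Proof.
move=> xa xb ab xc; have [->|ca] := eqVneq c a; [by left | right].
apply/eqP/negPn/negP => cb; have := valF x; rewrite /valency.
have /subset_leq_card : [set a; b; c] \subset [set y | F x y].
  by apply/subsetP => y; rewrite !inE => /orP[/orP[]|] /eqP->.
rewrite setUC cardsU1 cards2 ab !inE negb_or ca cb => le3 E.
by move: le3; rewrite E.
Qed.

Lemma other_neighbour x a : F x a -> exists2 b, F x b & b != a.
Proof.
move=> xa; have /cards2P[b [c [bc E]]] : #|[set y | F x y]| == 2.
  by rewrite -/(valency F x) valF.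
have Fb : F x b.
  by have : b \in [set y | F x y] by [rewrite E !inE eqxx]; rewrite inE.
have Fc : F x c.
  by have : c \in [set y | F x y] by [rewrite E !inE eqxx orbT]; rewrite inE.
have [ba|ba] := eqVneq b a; last by exists b.
by exists c; rewrite // -ba eq_sym.
Qed.

(* A path that cannot be prolonged closes up at its first vertex, since all the
   other vertices already have two neighbours on it. *)
Lemma closing_path u : exists p z, [/\ path F u (rcons p z), uniq (u :: rcons p z),
  F z u & p != [::]].
Proof.
have [a ua _] : exists2 a, F u a & true.
  have : 0 < #|[set y | F u y]| by rewrite -/(valency F u) valF.
  by case/card_gt0P => a; rewrite inE => ua; exists a.
have au : a != u by apply: contraTneq ua => ->; rewrite irrF.
(* [k] is fuel: it bounds how often the path can still grow. *)
have prolong k p z : #|T| <= k + size p -> path F u (rcons p z) ->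
    uniq (u :: rcons p z) -> exists p z, [/\ path F u (rcons p z),
      uniq (u :: rcons p z), F z u & p != [::]].
  elim: k p z => [|k IH] p z szp Fp up.
    have /leq_trans/(_ szp) := max_card [in u :: rcons p z].
    by rewrite (card_uniqP up) /= size_rcons; lia.
  have [Fp' zz] : path F u p /\ F z (last u p).
    by move: Fp; rewrite rcons_path symF => /andP[].
  have [w zw wp] := other_neighbour zz.
  have [wq|wq] := boolP (w \in u :: rcons p z); last first.
    apply: (IH (rcons p z) w); first by rewrite size_rcons; lia.
      by rewrite rcons_path Fp last_rcons.
    by rewrite -rcons_cons rcons_uniq wq.
  move: wq; rewrite inE mem_rcons inE => /orP[/eqP wu|/orP[/eqP wz|wp']].
  - exists p, z; split=> //; first by rewrite -wu.
    by apply: contraNneq wp => p0; rewrite wu p0.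
  - by move: zw; rewrite wz irrF.
  case/splitPr: wp' => p1 [|b p3] in Fp up wp szp Fp' zz *.
    by rewrite last_cat /= eqxx in wp.
  have [Fa Fb] : F w (last u p1) /\ F w b.
    by move: Fp'; rewrite cat_path /= symF => /and4P[].
  have zb : z \notin u :: p1 ++ [:: w, b & p3].
    by move: up; rewrite -rcons_cons rcons_uniq => /andP[].
  move: up; rewrite -rcons_cons rcons_uniq -cat_cons cat_uniq => /and3P[_ _].
  case/andP=> /hasPn disj _.
  have ab : last u p1 != b.
    have := disj b; rewrite !inE eqxx orbT => /(_ isT).
    by apply: contraNneq => <-; rewrite -in_cons mem_last.
  have wz : F w z by rewrite symF.
  have [Ez|Ez] := two_neighbours Fa Fb ab wz.
    by case/negP: zb; rewrite Ez -cat_cons mem_cat mem_last.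
  by case/negP: zb; rewrite Ez -cat_cons mem_cat !inE eqxx !orbT.
by apply: (prolong #|T| [::] a); rewrite /= ?ua ?inE ?andbT ?addn0 // eq_sym.
Qed.

(** On a cycle of length at least 3, [next c x] and [prev c x] differ, so they already exhaust the
    two neighbours of [x]. *)
Lemma cycle_neighbours c x y : cycle F c -> uniq c -> 2 < size c -> x \in c ->
  F x y -> cycle_edge c x y.
Proof.
move=> cF uc sc xc xy; have [i s Es] := rot_to xc.
have Fn : F x (next c x) by apply: next_cycle.
have Fp : F x (prev c x) by rewrite symF; apply: prev_cycle.
have np : next c x != prev c x.
  have N a : next c a = next (x :: s) a by rewrite -Es next_rot.
  apply/eqP => /(congr1 (next c)); rewrite next_prev // !N.
  case: s Es N => [|a [|b s]] Es N; try by move: sc; rewrite -(size_rot i) Es.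
  move: uc; rewrite -(rot_uniq i) Es /= !inE !negb_or eqxx.
  case/and3P=> /and3P[xa xb _] _ _; rewrite eq_sym (negPf xa) eqxx => bx.
  by rewrite bx eqxx in xb.
have := two_neighbours Fn Fp np xy; rewrite /cycle_edge xc => -[->|->].
  by rewrite mem_next xc eqxx.
by rewrite mem_prev xc next_prev // eqxx orbT.
Qed.

Lemma cycle_constant (f : T -> bool) c x y :
  (forall a b, F a b -> f a = f b) -> cycle F c -> x \in c -> y \in c ->
  f x = f y.
Proof.
move=> cf cF; pose e := [rel a b | f a == f b].
have e_trans : transitive e by move=> a b c' /= /eqP-> /eqP->.
suff all_eq z : z \in c -> f z = f (head z c).
  case: c cF all_eq => // w c _ all_eq xc yc.
  by rewrite (all_eq x xc) (all_eq y yc).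
case: c cF => // w c /= cF.
have /(order_path_min e_trans)/allP ew : path e w (rcons c w).
  by apply: sub_path cF => a b /cf /= ->.
by rewrite -mem_rcons => /ew /eqP <-.
Qed.

End TwoRegular.

(** * From labels on pairs of numbers to the graph [htg] *)

Section Bridge.
Variables m n : nat.
Hypotheses (m_gt1 : 2 <= m) (em : ~~ odd m) (n_gt3 : 4 <= n) (en : ~~ odd n).

Definition coords (x : htg_vertex m n) : vertex := (x.1 : nat, x.2 : nat).

Lemma coords_inj : injective coords.
Proof. by case=> [i j] [i' j'] [/val_inj -> /val_inj ->]. Qed.

Lemma inside_coords x : inside m n (coords x).
Proof. by rewrite /inside !ltn_ord. Qed.

Lemma coordsP x : inside m n x -> exists y, coords y = x.
Proof.
by case: x => i j /andP[/= im jn]; exists (Ordinal im, Ordinal jn).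
Qed.

(** The parity of the coordinate sum of [x] decides which disjuncts of [htg] can hold: flat and jump
    edges leave odd sums, and their reverses leave even ones. *)
Lemma htg_step x y :
  htg 2 x y = has (fun d => step m n d (coords x) == coords y) [:: Up; Dn; Fl].
Proof.
have mod1 j : j < n -> j.+1 %% n = incr n j.
  move=> jn; rewrite /incr; case: ltnP => jn1; first by rewrite modn_small.
  by have -> : j.+1 = n by [lia]; rewrite modnn.
have mod2 j : j < n -> (j + 2) %% n = add2 n j.
  move=> jn; rewrite /add2 addn2; case: ltnP => jn2; first by rewrite modn_small.
  rewrite -[in LHS](subnK jn2) addnC modnDl modn_small //; lia.
case: x y => [i j] [i' j']; rewrite /htg /htg_vertical /htg_flat /htg_jump /=.
rewrite !mod1 // !mod2 // !modn_small // (negPf em) !eqbF_neg -!val_eqE /=.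
rewrite /step /coords /= orbF !xpair_eqE.
have := ltn_ord i; have := ltn_ord j; have := ltn_ord i'; have := ltn_ord j'.
move: (i : nat) (j : nat) (i' : nat) (j' : nat) => {}i {}j {}i' {}j' jn' im' jn im.
have E1 : (j == incr n j') = (decr n j == j').
  by rewrite /incr /decr; split_ifs; lia.
have E2 : (j == add2 n j') = (sub2 n j == j').
  by rewrite /add2 /sub2; split_ifs; lia.
have odd2 k : k < n -> odd (add2 n k) = odd k.
  by rewrite /add2; split_ifs; lia.
have := odd2 _ jn; have := odd2 _ jn'; move: E2 => {odd2}.
move: (add2 n j) (add2 n j') (sub2 n j) => a2 a2' s2 E2 o' o.
rewrite {}E1 (eq_sym j' (incr n j)) (eq_sym i' i).
suff -> : (if odd (i + j) then if i.+1 < m then (i.+1, j) else (0, a2)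
    else if 0 < i then (i.-1, j) else (m.-1, s2)) == (i', j') =
    [|| [&& i' == i.+1, odd (i + j) & j' == j],
      [&& i == m.-1, i' == 0, ~~ odd j & j' == a2],
      [&& i == i'.+1, odd (i' + j') & j == j']
    | [&& i' == m.-1, i == 0, ~~ odd j' & j == a2']].
  by do 6 (case: (_ && _); rewrite ?orbT ?orbF //=).
have nC' : odd (i + j) -> [&& i' == m.-1, i == 0, ~~ odd j' & j == a2'] = false.
  by clear E2 => oij; apply/negP => /and4P[_ /eqP i0 oj' /eqP ja]; lia.
have nB' : odd (i + j) -> [&& i == i'.+1, odd (i' + j') & j == j'] = false.
  by clear E2 o o' => oij; apply/negP => /and3P[/eqP ii oj' /eqP ja]; lia.
case oij: (odd (i + j)); last clear nC' nB'.
  rewrite nC' // nB' // !orbF; clear E2 o o' nC' nB'; case: ifP => im1.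
    have -> : (i == m.-1) = false by lia.
    by rewrite orbF xpair_eqE /= (eq_sym i') (eq_sym j').
  have -> : (i' == i.+1) = false by lia.
  have [-> ->] : i == m.-1 /\ ~~ odd j by split; lia.
  by rewrite xpair_eqE /= (eq_sym i') (eq_sym j').
have nC : [&& i == m.-1, i' == 0, ~~ odd j & j' == a2] = false.
  by clear E2 o o'; apply/negP => /and4P[/eqP ii _ oj _]; lia.
rewrite nC andbF /= {nC}; case: ifP => i0; rewrite xpair_eqE.
  have -> : (i == 0) = false by lia.
  rewrite andbF orbF; clear E2 o o'; apply/andP/and3P => [[/eqP ? /eqP ?]|].
    by split; lia.
  by case=> /eqP ? _ /eqP ?; split; lia.
have -> : (i == i'.+1) = false by lia.
have -> : (i == 0) by lia.
rewrite -E2 /=; clear E2; rewrite (eq_sym i').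
case: (m.-1 == i') => //=; case: (j =P a2') => [ja|]; last by rewrite andbF.
by have -> : ~~ odd j' by lia.
Qed.

Definition adjacent (M : vertex -> dir) : rel (htg_vertex m n) := fun x y =>
  has (fun d => (M (coords x) != d) && (step m n d (coords x) == coords y))
    [:: Up; Dn; Fl].

Lemma adjacentP M x y :
  reflect (exists2 d, M (coords x) != d & step m n d (coords x) = coords y)
    (adjacent M x y).
Proof.
apply: (iffP hasP) => [[d _ /andP[Mx /eqP xy]]|[d Mx xy]]; first by exists d.
by exists d; [case: d {Mx xy} => [[]|] | rewrite Mx xy /=].
Qed.

Lemma adjacent_sym M : matched m n M -> symmetric (adjacent M).
Proof.
move=> MM; have sub x y : adjacent M x y -> adjacent M y x.
  case/adjacentP=> d Mx xy; apply/adjacentP; exists (flip d).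
    by rewrite -xy matched_step_neq // inside_coords.
  by rewrite -xy stepK // inside_coords.
by move=> x y; apply/idP/idP => /sub.
Qed.

Lemma adjacent_irr M : irreflexive (adjacent M).
Proof.
move=> x; apply/negbTE/adjacentP => -[d _ xx].
have := odd_step m_gt1 em n_gt3 en d (inside_coords x).
by rewrite xx; case: odd.
Qed.

(** By [eq_step], the neighbours correspond to the two directions other than the omitted one. *)
Lemma adjacent_valency M x : valency (adjacent M) x = 2.
Proof.
have [/= z zE] : exists z, forall d, coords (z d) = step m n d (coords x).
  have zP d : exists y, coords y == step m n d (coords x).
    have [|y Ey] := @coordsP (step m n d (coords x)).
      by apply: inside_step; rewrite ?inside_coords.
    by exists y; apply/eqP.
  by exists (fun d => xchoose (zP d)) => d; apply/eqP/(xchooseP (zP d)).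
have zI d d' : (z d == z d') = (d == d').
  by rewrite -(inj_eq coords_inj) !zE (eq_step m_gt1 em n_gt3 en) // inside_coords.
have -> : valency (adjacent M) x = #|[set d : dir | M (coords x) != d]|.
  rewrite /valency -(card_imset _ (f := z)); last first.
    by move=> d d' /eqP; rewrite zI => /eqP.
  apply: eq_card => y; rewrite inE; apply/adjacentP/imsetP => -[d].
    move=> Mx xy; exists d; rewrite ?inE //; apply: coords_inj.
    by rewrite zE.
  by rewrite inE => Mx ->; exists d.
have -> : [set d : dir | M (coords x) != d] = [set~ M (coords x)].
  by apply/setP => d; rewrite !inE eq_sym.
by rewrite cardsC1 card_option card_bool.
Qed.

(** The cycles through [u] and [v] come from [closing_path]; the colour [X] keeps them disjoint, and
    the absence of a third component makes them cover the graph. *)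
Lemma two_spanning_cyclableP :
  (forall u v, inside m n u -> inside m n v -> u != v -> separable m n u v) ->
  two_spanning_cyclable (htg (m := m) (n := n) 2).
Proof.
move=> sep u v uv.
have [|M [MM [X [cX Xu Xv]] R]] := sep _ _ (inside_coords u) (inside_coords v).
  by rewrite (inj_eq coords_inj).
pose F := adjacent M; have symF : symmetric F := adjacent_sym MM.
have irrF : irreflexive F := @adjacent_irr M.
have valF : forall x, valency F x = 2 := adjacent_valency M.
have cycle_through w : exists c, [/\ graph_cycle F c, w \in c &
    forall x y, x \in c -> F x y -> cycle_edge c x y].
  have [p [z [Fp up zw p0]]] := closing_path symF irrF valF w.
  have sz : 2 < size (w :: rcons p z) by rewrite /= size_rcons; case: (p) p0.
  have cF : cycle F (w :: rcons p z) by rewrite /= rcons_path Fp last_rcons.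
  exists (w :: rcons p z); split; rewrite ?mem_head //.
    by split=> //; apply/andP.
  by move=> x y; apply: (cycle_neighbours symF valF).
have [c1 [gc1 uc1 nc1]] := cycle_through u.
have [c2 [gc2 vc2 nc2]] := cycle_through v.
have edgeF c x y : graph_cycle F c -> cycle_edge c x y -> F x y.
  case=> /andP[cF _] _ /and3P[xc yc] /orP[] /eqP->; first exact: next_cycle.
  by rewrite symF; apply: next_cycle.
have constX x y : F x y -> X (coords y) = X (coords x).
  by case/adjacentP=> d Mx <-; apply: cX; rewrite ?inside_coords.
exists F; split.
  split=> //; split=> // x y /adjacentP[d _ xy]; rewrite htg_step.
  by apply/hasP; exists d; [case: d {xy} => [[]|] | rewrite xy].
exists c1, c2; split=> //; split=> //.
  rewrite disjoint_has; apply/hasPn => x xc1; apply/negP => xc2.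
  have cX' x' y' : F x' y' -> X (coords x') = X (coords y') by move/constX.
  case: gc1 gc2 => /andP[F1 _] _ [/andP[F2 _] _]; case/negP: Xv.
  by rewrite -(cycle_constant cX' F2 xc2 vc2) -(cycle_constant cX' F1 uc1 xc1).
move=> x y; apply/idP/orP => [xy|[] ]; last 2 first.
- exact: edgeF.
- exact: edgeF.
(* [separates] quantifies over predicates on pairs of numbers, so [In] is carried over to them as
   [P]. *)
pose In y := (y \in c1) || (y \in c2).
have In_step a b : F a b -> In a -> In b.
  by rewrite /In => ab /orP[/nc1|/nc2] /(_ _ ab)/and3P[_ -> _]; rewrite ?orbT.
pose P z := [exists y, (coords y == z) && In y].
have PE y' : P (coords y') = In y'.
  apply/existsP/idP => [[y'' /andP[/eqP/coords_inj->]]//|y'c].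
  by exists y'; rewrite eqxx.
have : P (coords x).
  apply: R; rewrite ?inside_coords ?PE /In ?uc1 ?vc2 ?orbT //.
  move=> z d zV; have [a <-] := coordsP zV.
  have [b Eb] := coordsP (inside_step m_gt1 em n_gt3 en d (inside_coords a)).
  move=> Ma; rewrite -Eb !PE; have ab : F a b by apply/adjacentP; exists d.
  by apply/idP/idP; apply: In_step; rewrite // symF.
by rewrite PE => /orP[] xc; [left; apply: nc1 | right; apply: nc2].
Qed.

End Bridge.

(** * The obstruction from two linked 4-cycles *)

Section Obstruction.
Variables (T : finType) (e : rel T) (o a0 a1 a2 a3 b0 b1 b2 b3 : T).
Hypothesis distinct : uniq [:: o; a0; a1; a2; a3; b0; b1; b2; b3].
Hypotheses (ea1 : forall x, e a1 x -> x \in [:: a0; a2; b1])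
  (ea3 : forall x, e a3 x -> x \in [:: a0; a2; b3])
  (eb1 : forall x, e b1 x -> x \in [:: b0; b2; a1])
  (eb3 : forall x, e b3 x -> x \in [:: b0; b2; a3]).

Lemma two_of_three (F : rel T) x p q r : valency F x = 2 ->
  (forall y, F x y -> y \in [:: p; q; r]) -> ~~ F x r -> F x p /\ F x q.
Proof.
move=> vx nx xr; suff E : [set y | F x y] = [set p; q].
  have [Np Nq] : p \in [set p; q] /\ q \in [set p; q] by rewrite !inE !eqxx orbT.
  by move: Np Nq; rewrite -E !inE.
apply/eqP; rewrite eqEcard; apply/andP; split; last first.
  by rewrite [X in _ <= X]vx cards2; case: (p == q).
apply/subsetP => y; rewrite !inE => xy.
have := nx y xy; rewrite !inE => /or3P[-> //|->|/eqP yr]; first by rewrite orbT.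
by rewrite -yr xy in xr.
Qed.

(* The 4-cycles [a0 a1 a2 a3] and [b0 b1 b2 b3] are joined by [a1 b1] and
   [a3 b3].  If [a1 b1] is dropped, then either [a3 b3] is kept and both
   quadruples lie on one cycle, or both quadruples are cycles missing [o]. *)
Lemma adjacent_quadrilaterals : ~ two_spanning_cyclable e.
Proof.
have ab1 : a1 != b1.
  by move: distinct; rewrite /= !inE !negb_or => /and5P[_ _ /and5P[]].
case/(_ a1 b1 ab1) => F [[[symF Fe] valF] [c1 [c2]]].
case=> [[[uF1 sc1] [uF2 sc2] disj FE] a1c b1c].
have {uF1}F1 : cycle F c1 by case/andP: uF1.
have {uF2}F2 : cycle F c2 by case/andP: uF2.
have c2N x : x \in c2 -> x \notin c1.
  by move=> xc2; apply: contraTN xc2 => xc1; rewrite (disjointFr disj).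
have FX x y : F x y -> (x \in c1) = (y \in c1).
  rewrite FE => /orP[] /and3P[xc yc _]; first by rewrite xc yc.
  by rewrite !(negPf (c2N _ _)).
have b1N := c2N _ b1c.
have Fab1 : ~~ F a1 b1 by apply: contraNN b1N => /FX <-.
have [Fa10 Fa12] := two_of_three (valF a1) (fun x => fun H => ea1 (Fe _ _ H)) Fab1.
have Fba1 : ~~ F b1 a1 by rewrite symF.
have [Fb10 Fb12] := two_of_three (valF b1) (fun x => fun H => eb1 (Fe _ _ H)) Fba1.
have [Fab3|Fab3] := boolP (F a3 b3).
  have [x /[dup] Fx /Fe/ea3 + xb] := other_neighbour valF Fab3.
  rewrite !inE (negPf xb) orbF => xa.
  have a3c : a3 \in c1.
    by rewrite (FX _ _ Fx); case/orP: xa => /eqP->; rewrite -(FX a1).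
  have Fba3 : F b3 a3 by rewrite symF.
  have [y /[dup] Fy /Fe/eb3 + ya] := other_neighbour valF Fba3.
  rewrite !inE (negPf ya) orbF => yb; case/negP: b1N.
  have yc : y \in c1 by rewrite -(FX _ _ Fy) -(FX _ _ Fab3).
  by case/orP: yb yc => /eqP->; rewrite -(FX b1).
have Fba3 : ~~ F b3 a3 by rewrite symF.
have [Fa30 Fa32] := two_of_three (valF a3) (fun x => fun H => ea3 (Fe _ _ H)) Fab3.
have [Fb30 Fb32] := two_of_three (valF b3) (fun x => fun H => eb3 (Fe _ _ H)) Fba3.
(* The four given edges supply both neighbours of every corner, so no edge of [F] leaves the
   quadruple. *)
have closed4 p0 p1 p2 p3 : p0 != p2 -> p1 != p3 ->
    F p1 p0 -> F p1 p2 -> F p3 p0 -> F p3 p2 ->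
    forall x y, F x y -> (x \in [:: p0; p1; p2; p3]) = (y \in [:: p0; p1; p2; p3]).
  move=> p02 p13 F10 F12 F30 F32.
  have [F01 F03 F21 F23] : [/\ F p0 p1, F p0 p3, F p2 p1 & F p2 p3].
    by split; rewrite symF.
  have sub x y : F x y -> x \in [:: p0; p1; p2; p3] -> y \in [:: p0; p1; p2; p3].
    move=> xy; rewrite !inE => /or4P[] /eqP Ex; rewrite {}Ex in xy.
    - by have [->|->] := two_neighbours valF F01 F03 p13 xy; rewrite eqxx ?orbT.
    - by have [->|->] := two_neighbours valF F10 F12 p02 xy; rewrite eqxx ?orbT.
    - by have [->|->] := two_neighbours valF F21 F23 p13 xy; rewrite eqxx ?orbT.
    - by have [->|->] := two_neighbours valF F30 F32 p02 xy; rewrite eqxx ?orbT.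
  by move=> x y xy; apply/idP/idP; apply: sub; rewrite // symF.
(* Having a neighbour, [o] lies on one of the two cycles, which would then have to leave its closed
   quadruple. *)
have /card_gt0P[x] : 0 < #|[set y | F o y]| by rewrite -/(valency F o) valF.
rewrite inE FE => oF.
have [oc|oc] : o \in c1 \/ o \in c2.
  by case/orP: oF => /and3P[? _ _]; [left | right].
- have : uniq [:: o; a0; a1; a2; a3].
    exact: subseq_uniq (mask_subseq (nseq 5 true) _) distinct.
  case/and4P=> oA a0N a1N _.
  have a02 : a0 != a2 by move: a0N; rewrite !inE !negb_or => /and3P[].
  have a13 : a1 != a3 by move: a1N; rewrite !inE !negb_or => /andP[].
  have := cycle_constant (closed4 _ _ _ _ a02 a13 Fa10 Fa12 Fa30 Fa32) F1 oc a1c.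
  by rewrite (negPf oA) !inE eqxx orbT.
have : uniq [:: o; b0; b1; b2; b3].
  exact: subseq_uniq (mask_subseq (true :: nseq 4 false ++ nseq 4 true) _) distinct.
case/and4P=> oB b0N b1N' _.
have b02 : b0 != b2 by move: b0N; rewrite !inE !negb_or => /and3P[].
have b13 : b1 != b3 by move: b1N'; rewrite !inE !negb_or => /andP[].
have := cycle_constant (closed4 _ _ _ _ b02 b13 Fb10 Fb12 Fb30 Fb32) F2 oc b1c.
by rewrite (negPf oB) !inE eqxx orbT.
Qed.

End Obstruction.

Lemma htg_obstruction m n (o a0 a1 a2 a3 b0 b1 b2 b3 : vertex) :
  2 <= m -> ~~ odd m -> 4 <= n -> ~~ odd n ->
  uniq [:: o; a0; a1; a2; a3; b0; b1; b2; b3] ->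
  all (inside m n) [:: o; a0; a1; a2; a3; b0; b1; b2; b3] ->
  (forall d, [/\ step m n d a1 \in [:: a0; a2; b1],
    step m n d a3 \in [:: a0; a2; b3],
    step m n d b1 \in [:: b0; b2; a1]
    & step m n d b3 \in [:: b0; b2; a3]]) ->
  ~ two_spanning_cyclable (htg (m := m) (n := n) 2).
Proof.
move=> m2 em n4 en un ins st.
have lift x : inside m n x -> exists y, coords (m := m) (n := n) y == x.
  by move/coordsP=> [y <-]; exists y.
move: un st; case/and5P: ins => /lift[o' /eqP<-] /lift[a0' /eqP<-].
move=> /lift[a1' /eqP<-] /lift[a2' /eqP<-] /and5P[/lift[a3' /eqP<-]].
move=> /lift[b0' /eqP<-] /lift[b1' /eqP<-] /lift[b2' /eqP<-].
case/andP=> /lift[b3' /eqP<-] _ un st.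
have cE s x : (coords x \in map (@coords m n) s) = (x \in s).
  exact: (mem_map (@coords_inj m n)).
apply: (@adjacent_quadrilaterals _ _ o' a0' a1' a2' a3' b0' b1' b2' b3').
- by rewrite -(map_inj_uniq (@coords_inj m n)).
all: move=> x; rewrite htg_step // -cE => /hasP[d _ /eqP <-].
all: by case: (st d).
Qed.

Lemma htg_4_not m : 4 <= m -> ~~ odd m ->
  ~ two_spanning_cyclable (htg (m := m) (n := 4) 2).
Proof.
(* With four rows each column is a 4-cycle; columns 0 and 1 are joined by the flat edges in rows 1
   and 3, and [o] is taken in column 2. *)
move=> m4 em; apply: (@htg_obstruction m 4 (2, 0) (0, 0) (0, 1) (0, 2) (0, 3)
  (1, 0) (1, 1) (1, 2) (1, 3)) => //; try lia.
  by rewrite /inside /=; lia.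
case: m m4 em => [|[|[|[|m]]]] // _ _.
by case=> [[]|]; split.
Qed.

Lemma htg_2_not n : 6 <= n -> ~~ odd n ->
  ~ two_spanning_cyclable (htg (m := 2) (n := n) 2).
Proof.
(* With two columns a jump edge, a flat edge and two vertical edges bound a 4-cycle; the two taken
   here contain the jump edges from rows 0 and 2, and [6 <= n] keeps row 4 apart from row 0. *)
move=> n6 en; apply: (@htg_obstruction 2 n (0, 0) (0, 1) (1, 1) (1, 0) (0, 2)
  (0, 4) (1, 2) (1, 3) (0, 3)) => //; try lia.
  by rewrite /inside /=; lia.
case: n n6 en => [|[|[|[|[|[|n]]]]]] // _ _.
by case=> [[]|]; split.
Qed.

Unset Implicit Arguments.

Theorem theorem5p2 (m n : nat) (hm : 2 <= m) (em : ~~ odd m)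
    (hn : 4 <= n) (en : ~~ odd n) :
  two_spanning_cyclable (@htg m n 2) <->
  (m, n) = (2, 4) \/ (4 <= m /\ 6 <= n).
Proof.
split=> [cyc|[[-> ->]|[m4 n6]]].
- have [m2|m4] : m = 2 \/ 4 <= m by lia.
    have [n4|n6] : n = 4 \/ 6 <= n by lia.
      by left; rewrite m2 n4.
    by move: cyc; rewrite m2 => /(htg_2_not n6 en).
  have [n4|n6] : n = 4 \/ 6 <= n by lia.
    by move: cyc; rewrite n4 => /(htg_4_not m4 em).
  by right.
- apply: two_spanning_cyclableP => // u v uV vV uv.
  apply: separable_from_origin uV _ vV _ => //; last by rewrite eq_sym.
  by move=> w; apply: separable_2_4.
- apply: two_spanning_cyclableP => //; exact: separable_grow.
Qed.
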